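(* Let $k\ge 1$ and let $v_1,\dots,v_n\in\mathbb{R}^d$ be an arbitrary (fixed) sequence of $n$ vectors. Let $W^*$ be the optimal $k$-means cost of this multiset, and let $w^*>0$ be any number with $w^*\le W^*$. Run the semi-online $k$-means algorithm (described in the context) on the sequence with inputs $k$, $w^*$, $n$, and let $C$ be its final set of centers. Then $$\mathbb{E}[|C|]=O\!\left(k\log n\,\log\frac{W^*}{w^*}\right),$$ where the expectation is over the algorithm's internal randomness and the constant in $O(\cdot)$ is absolute (independent of $n,k,d,w^*$ and of the data).
   Context: Norms are Euclidean, and $\log$ denotes the base-2 logarithm. The optimal $k$-means cost of vectors $v_1,\dots,v_n$ is $W^*=\min\sum_{i=1}^k\sum_{v\in S_i}\|v-c_i\|_2^2$, the minimum taken over all partitions of the vectors into $k$ sets $S_1,\dots,S_k$ and all choices of centers $c_1,\dots,c_k\in\mathbb{R}^d$. For a point $v$ and a finite set $C$, $D(v,C)=\min_{c\in C}\|v-c\|$, with $D(v,\emptyset)=\infty$. Semi-online $k$-means algorithm (inputs: the stream $v_1,\dots,v_n$, $k$, $w^*$, $n$): initialize $C\gets\emptyset$, $r\gets1$, $q_1\gets0$, $f_1\gets w^*/(k\log n)$. For each vector $v$ of the stream, in order: with probability $p=\min(D^2(v,C)/f_r,1)$ (independently of all other random choices), set $C\gets C\cup\{v\}$ and $q_r\gets q_r+1$; then, if $q_r\ge 3k(1+\log n)$, set $r\gets r+1$, $q_r\gets0$, $f_r\gets 2f_{r-1}$; finally output (assign $v$ to) the center $c=\arg\min_{c\in C}\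|v-c\|^2$.
   Formalization: The factor log(W*/w* ) is read as max(1, log(W*/w* )), since for w* = W* the stated bound would be 0 although the first vector is always chosen as a center; for w* ≤ W*/2 the bound is as stated. *)

(* Defs.v *)
From HB Require Import structures.
From mathcomp Require Import all_boot all_order all_algebra finmap.
From mathcomp Require Import mathcomp_extra boolp classical_sets reals ereal.
From mathcomp Require Import sequences exp.
From mathcomp Require Import ring lra.
Set Implicit Arguments. Unset Strict Implicit. Unset Printing Implicit Defensive.
Import Order.TTheory GRing.Theory Num.Theory.
Local Open Scope ring_scope.

Definition log2 {R : realType} (x : R) : R := ln x / ln 2.

(* The library's norm on 'rV[R]_d is the sup norm, hence this definition. *)
Definition enorm {R : realType} {d : nat} (u : 'rV[R]_d) : R :=
  Num.sqrt (\sum_(j < d) u 0 j ^+ 2).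

(** * Optimal k-means cost *)

(* A partition into k (possibly empty) sets is encoded by the map [a] sending
   the index of a vector to the index of its set; working with the indices
   j < n keeps track of multiplicities. *)
Definition kmeans_cost {R : realType} {d n k : nat} (v : n.-tuple 'rV[R]_d)
    (a : {ffun 'I_n -> 'I_k}) (c : 'I_k -> 'rV[R]_d) : R :=
  \sum_(i < k) \sum_(j < n | a j == i) enorm (tnth v j - c i) ^+ 2.

(* This infimum is a minimum when k > 0: see [kmeans_opt_min] below. *)
Definition kmeans_opt {R : realType} {d n : nat} (k : nat)
    (v : n.-tuple 'rV[R]_d) : R :=
  inf [set x : R | exists (a : {ffun 'I_n -> 'I_k}) (c : 'I_k -> 'rV[R]_d),
                     x = kmeans_cost v a c]%classic.

(** * The semi-online algorithm *)

Definition Dist {R : realType} {d : nat} (u : 'rV[R]_d) (C : {fset 'rV[R]_d}) :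
    \bar R :=
  \big[Order.min/+oo%E]_(c <- C) (enorm (u - c))%:E.

(* The current phase r is only used through the current values of q_r and
   f_r, which are the ones recorded. *)
Record state (R : realType) (d : nat) := State {
  centers : {fset 'rV[R]_d};
  quota : nat;
  fcost : R }.

Definition init_state (R : realType) (d k n : nat) (w : R) : state R d :=
  State fset0 0 (w / (k%:R * log2 n%:R)).

(* The minimum is finite, being at most 1, so [fine] loses nothing. *)
Definition accept_prob {R : realType} {d : nat} (s : state R d)
    (u : 'rV[R]_d) : R :=
  fine (Order.min (Dist u (centers s) ^+ 2 * ((fcost s)^-1)%:E) 1)%E.

Definition step {R : realType} {d : nat} (k n : nat) (s : state R d)
    (u : 'rV[R]_d) (b : bool) : state R d :=
  let C := if b then (u |` centers s)%fset else centers s in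
  let q := if b then (quota s).+1 else quota s in
  if 3 * k%:R * (1 + log2 n%:R) <= q%:R :> R
  then State C 0 (2 * fcost s)
  else State C q (fcost s).

Fixpoint run {R : realType} {d : nat} (k n : nat) (s : state R d)
    (vs : seq 'rV[R]_d) (bs : seq bool) : state R d :=
  match vs, bs with
  | u :: vs', b :: bs' => run k n (step k n s u b) vs' bs'
  | _, _ => s
  end.

(* Probability that the successive accept/reject decisions are [bs]: the
   product of their conditional probabilities given the past. *)
Fixpoint run_prob {R : realType} {d : nat} (k n : nat) (s : state R d)
    (vs : seq 'rV[R]_d) (bs : seq bool) : R :=
  match vs, bs with
  | u :: vs', b :: bs' =>
      (if b then accept_prob s u else 1 - accept_prob s u) *
      run_prob k n (step k n s u b) vs' bs'
  | _, _ => 1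
  end.

Definition expected_centers {R : realType} {d n : nat} (k : nat) (w : R)
    (v : n.-tuple 'rV[R]_d) : R :=
  let s0 := init_state d k n w in
  \sum_(b : n.-tuple bool)
    run_prob k n s0 v b * #|` centers (run k n s0 v b)|%:R.

(** * Sanity checks *)

Lemma accept_prob_itv (R : realType) (d : nat) (s : state R d) (u : 'rV[R]_d) :
  0 < fcost s -> 0 <= accept_prob s u <= 1.
Proof.
move=> f0; rewrite /accept_prob.
have D0 : (0 <= Dist u (centers s))%E.
  rewrite /Dist; elim/big_ind: _ => [|x y x0 y0|c _].
  - exact: leey.
  - by rewrite le_min x0 y0.
  - by rewrite lee_fin sqrtr_ge0.
have : (0 <= Dist u (centers s) ^+ 2 * ((fcost s)^-1)%:E)%E.
  apply: mule_ge0; first exact: mule_ge0.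
  by rewrite lee_fin invr_ge0 ltW.
case: (_ * _)%E => [x| |] //.
- rewrite lee_fin => x0; rewrite -EFin_min /= le_min x0 ler01 /=.
  by rewrite ge_min lexx orbT.
- by move=> _; rewrite minye /= ler01 lexx.
Qed.

Lemma run_prob_sum1 (R : realType) (d k n m : nat) (s : state R d)
    (vs : m.-tuple 'rV[R]_d) :
  \sum_(b : m.-tuple bool) run_prob k n s vs b = 1.
Proof.
elim: m s vs => [|m IH] s vs.
  rewrite (bigD1 [tuple]) //= big1 ?addr0.
    by rewrite tuple0.
  by move=> b /negP[]; apply/eqP; rewrite tuple0.
case/tupleP: vs => u vs.
rewrite (reindex (fun p : bool * m.-tuple bool => [tuple of p.1 :: p.2])) /=.
  rewrite -(pair_bigA _ (fun b (t : m.-tuple bool) =>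
    (if b then accept_prob s u else 1 - accept_prob s u) *
      run_prob k n (step k n s u b) vs t)) /=.
  under eq_bigr do rewrite -big_distrr /= IH mulr1.
  by rewrite big_bool /= addrCA subrr addr0.
exists (fun t => (thead t, [tuple of behead t])) => [[b t] _|t _] /=.
  by congr (_, _); apply: val_inj.
by rewrite -tuple_eta.
Qed.

Lemma sum_sqr_mean (R : realType) (I : finType) (P : pred I) (x : I -> R)
    (c : R) :
  \sum_(j | P j) (x j - (\sum_(j | P j) x j) / #|P|%:R) ^+ 2
  <= \sum_(j | P j) (x j - c) ^+ 2.
Proof.
have [P0|Pn] := eqVneq #|P| 0%N.
  by rewrite !big_pred0 // => j; apply: (card0_eq P0).
set m := (_ / _).
have mE : \sum_(j | P j) x j = #|P|%:R * m.
  by rewrite mulrC divfK // pnatr_eq0.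
rewrite -subr_ge0 -sumrB.
rewrite (eq_bigr (fun j => (2 * (m - c)) * x j - (m - c) * (m + c)));
  last by move=> j _; ring.
rewrite sumrB -big_distrr /= mE sumr_const -mulr_natl.
rewrite (_ : _ - _ = #|P|%:R * (m - c) ^+ 2); last by ring.
by rewrite mulr_ge0 ?ler0n ?sqr_ge0.
Qed.

Lemma kmeans_opt_min (R : realType) (d n k : nat) (v : n.-tuple 'rV[R]_d) :
  (0 < k)%N ->
  (exists (a : {ffun _ -> 'I_k}) c, kmeans_opt k v = kmeans_cost v a c) /\
  (forall (a : {ffun _ -> 'I_k}) c, kmeans_opt k v <= kmeans_cost v a c).
Proof.
move=> k0.
pose mean (a : {ffun 'I_n -> 'I_k}) (i : 'I_k) : 'rV[R]_d :=
  \row_l ((\sum_(j | a j == i) tnth v j 0 l) / #|[pred j | a j == i]|%:R).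
have meanP a c : kmeans_cost v a (mean a) <= kmeans_cost v a c.
  apply: ler_sum => i _.
  have E (y : 'rV[R]_d) : \sum_(j < n | a j == i) enorm (tnth v j - y) ^+ 2 =
      \sum_(l < d) \sum_(j < n | a j == i) (tnth v j 0 l - y 0 l) ^+ 2.
    rewrite exchange_big /=; apply: eq_bigr => j _.
    rewrite sqr_sqrtr ?sumr_ge0 // => [|l _]; last exact: sqr_ge0.
    by apply: eq_bigr => l _; rewrite !mxE.
  rewrite !E; apply: ler_sum => l _; rewrite mxE.
  exact: (@sum_sqr_mean R _ [pred j | a j == i] (fun j => tnth v j 0 l)).
pose a0 : {ffun 'I_n -> 'I_k} := [ffun=> Ordinal k0].
case: (@arg_minP _ R _ a0 predT (fun a => kmeans_cost v a (mean a)) isT).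
move=> a _ aP.
set S := [set x : R | exists (a : {ffun 'I_n -> 'I_k}) c,
  x = kmeans_cost v a c]%classic.
have lbS : lbound S (kmeans_cost v a (mean a)).
  by move=> _ [b [c ->]]; apply: le_trans (aP b isT) (meanP b c).
have aS : S (kmeans_cost v a (mean a)) by exists a, (mean a).
have SE : kmeans_opt k v = kmeans_cost v a (mean a).
  apply/eqP; rewrite eq_le; apply/andP; split.
    by apply: ge_inf aS; exists (kmeans_cost v a (mean a)).
  by apply: lb_le_inf lbS; exists (kmeans_cost v a (mean a)).
split; first by exists a, (mean a).
by move=> b c; rewrite SE; apply: lbS; exists b, c.
Qed.

(* Main.v *)
Require Import Defs.
From mathcomp Require Import all_boot all_order all_algebra finmap.
From mathcomp Require Import boolp reals ereal exp.
From mathcomp Require Import ring lra.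
Set Implicit Arguments. Unset Strict Implicit. Unset Printing Implicit Defensive.
Import Order.TTheory GRing.Theory Num.Theory.
Local Open Scope ring_scope.

(** Let [W] be the optimal cost and call a state late once its [f] is at least
    [W / (k log n)].  Since [f] doubles at each phase change, there are at most
    [1 + log (W / w)] early phases, each adding [O(k log n)] centers.

    For the late phases, fix an optimal clustering and cut each cluster into
    [O(log n)] rings, ring [t] consisting of the points at squared distance
    about [2 ^ t * W / n] from the cluster center.  The first center selected in
    each ring costs [O(k log n)] overall.  Once its ring contains a center, a
    point at squared distance [x] from its cluster center has
    [D^2 <= 6 x + 2 W / n], and these bounds sum to [8 W], so the expected number
    of further late centers is at most [8 W / (W / (k log n)) = 8 k log n]. *)

(** * Base-2 logarithms and dyadic scales *)

Section RealFacts.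
Context {R : realType}.
Implicit Types x a : R.

Lemma ln2_gt0 : 0 < ln 2 :> R.
Proof. by apply: ln_gt0; rewrite ltr1n. Qed.

Lemma log2_ge0 x : 1 <= x -> 0 <= log2 x.
Proof. by move=> x1; apply: divr_ge0; [exact: ln_ge0 | exact/ltW/ln2_gt0]. Qed.

Lemma log2_nat_ge1 n : (2 <= n)%N -> 1 <= log2 n%:R :> R.
Proof.
move=> n2; rewrite /log2 ler_pdivlMr ?ln2_gt0 // mul1r.
by rewrite ler_ln ?posrE ?ltr0n ?ler_nat // (leq_trans _ n2).
Qed.

Lemma floor_log2 x : 1 <= x ->
  exists2 m : nat, x <= 2 ^+ m.+1 & m%:R <= log2 x.
Proof.
move=> x1; have x0 : 0 < x by exact: lt_le_trans x1.
exists (Num.truncn (log2 x)); last by rewrite truncn_le log2_ge0.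
rewrite -ler_ln ?posrE ?exprn_gt0 // lnXn ?ltr0n //.
rewrite -[ln 2 *+ _]mulr_natl -ler_pdivrMr ?ln2_gt0 //.
by rewrite ltW // truncnS_gt.
Qed.

(** The least [t] with [x <= 2 ^+ t * a] works: for [t > 0] minimality gives [2 ^+ t * a < 2 * x],
    and for [t = 0] the scale is [a] itself. *)
Lemma dyadic_scale x a m : 0 <= x -> x <= 2 ^+ m * a ->
  exists2 t, (t <= m)%N & (x <= 2 ^+ t * a) && (2 ^+ t * a <= 2 * x + a).
Proof.
move=> x0 xm; have exP : exists t, x <= 2 ^+ t * a by exists m.
case: (ex_minnP exP) => t xt tmin; exists t; first exact: tmin.
rewrite xt /=; case: t xt tmin => [|t] xt tmin.
  by rewrite expr0 mul1r lerDr mulr_ge0.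
have : 2 ^+ t * a < x.
  by rewrite ltNge; apply/negP => /tmin; rewrite ltnn.
have a0 : 0 <= a.
  by move: (le_trans x0 xt); rewrite pmulr_rge0 // exprn_gt0.
rewrite exprS; nra.
Qed.

End RealFacts.

(** * Euclidean distances and the acceptance probability *)

Section Norm.
Context {R : realType} {d : nat}.
Implicit Types (u c : 'rV[R]_d) (C : {fset 'rV[R]_d}).

Lemma enorm_sqr u : enorm u ^+ 2 = \sum_(l < d) u 0 l ^+ 2.
Proof. by rewrite sqr_sqrtr // sumr_ge0 // => l _; exact: sqr_ge0. Qed.

Lemma enorm0 : enorm (0 : 'rV[R]_d) = 0.
Proof.
apply/eqP; rewrite -sqrf_eq0 enorm_sqr big1 // => l _.
by rewrite mxE expr0n.
Qed.

(** In each coordinate the right side exceeds the left by exactly [(x + y - 2 * z) ^+ 2]. *)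
Lemma enorm_sqr_triangle u u' c :
  enorm (u - u') ^+ 2 <= 2 * (enorm (u - c) ^+ 2 + enorm (u' - c) ^+ 2).
Proof.
rewrite !enorm_sqr -big_split big_distrr /=; apply: ler_sum => l _.
rewrite !mxE; set x := u 0 l; set y := u' 0 l; set z := c 0 l.
have := sqr_ge0 (x + y - 2 * z); nra.
Qed.

Lemma Dist_ge0 u C : (0 <= Dist u C)%E.
Proof.
rewrite /Dist; elim/big_ind: _ => [|x y x0 y0|c _]; first exact: leey.
  by rewrite le_min x0 y0.
by rewrite lee_fin sqrtr_ge0.
Qed.

Lemma Dist_le u C c : c \in C -> (Dist u C <= (enorm (u - c))%:E)%E.
Proof. by move=> cC; rewrite /Dist (big_rem c) //= ge_min lexx. Qed.

(** The presence of [c] makes [Dist] finite, and the truncation at 1 only lowers the ratio. *)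
Lemma accept_prob_le (s : state R d) u c : 0 < fcost s -> c \in centers s ->
  accept_prob s u <= enorm (u - c) ^+ 2 / fcost s.
Proof.
move=> f0 cC; rewrite /accept_prob.
move: (Dist_ge0 u (centers s)) (Dist_le u cC).
case: (Dist u (centers s)) => [x| |] //; rewrite !lee_fin => x0 xc.
rewrite -EFin_expe -EFinM -EFin_min /=.
rewrite ge_min ler_pM2r ?invr_gt0 //.
by rewrite lerXn2r ?nnegrE ?(le_trans x0 xc).
Qed.

End Norm.

(** * The optimal cost *)

Section KMeansCost.
Context {R : realType} {d n k : nat} (v : n.-tuple 'rV[R]_d).

Lemma kmeans_costE (a : {ffun 'I_n -> 'I_k}) c :
  kmeans_cost v a c = \sum_j enorm (tnth v j - c (a j)) ^+ 2.
Proof.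
rewrite /kmeans_cost (partition_big a predT) //=.
by apply: eq_bigr => i _; apply: eq_bigr => j /eqP ->.
Qed.

(** A lone vector can be its own center at cost 0. The lemma serves to get [1 <= log2 n%:R] in the
    final estimate. *)
Lemma kmeans_opt_gt0_size : (0 < k)%N -> 0 < kmeans_opt k v -> (2 <= n)%N.
Proof.
move=> k0; apply: contraTT; rewrite -ltnNge ltnS => n1; rewrite -leNgt.
pose c : 'I_k -> 'rV[R]_d := fun=> head 0 v.
have [_ /(_ [ffun=> Ordinal k0] c)] := kmeans_opt_min v k0.
move=> /le_trans; apply; rewrite kmeans_costE big1 // => j _.
rewrite (tnth_nth 0) (_ : nat_of_ord j = 0%N); last first.
  by apply/eqP; rewrite -leqn0 -ltnS; apply: leq_trans n1.
by rewrite nth0 subrr enorm0 expr0n.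
Qed.

End KMeansCost.

(** * The expectation as a recursion along the stream *)

Section Expectation.
Context {R : realType} {d : nat} (k n : nat).
Implicit Types (s : state R d) (u : 'rV[R]_d).

(** Expected final number of centers when [vs] remains to be read from state [s], obtained by
    conditioning on the next decision; this form allows induction on the stream. *)
Fixpoint mean_centers s (vs : seq 'rV[R]_d) : R :=
  if vs is u :: vs' then
    accept_prob s u * mean_centers (step k n s u true) vs' +
    (1 - accept_prob s u) * mean_centers (step k n s u false) vs'
  else #|` centers s|%:R.

Lemma mean_centersE m s (vs : m.-tuple 'rV[R]_d) :
  \sum_(b : m.-tuple bool) run_prob k n s vs b * #|` centers (run k n s vs b)|%:R
  = mean_centers s vs.
Proof.
elim: m s vs => [|m IH] s vs.
  rewrite (bigD1 [tuple]) //= big1 ?addr0.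
    by rewrite tuple0 /= mul1r.
  by move=> b /negP[]; apply/eqP; rewrite tuple0.
case/tupleP: vs => u vs.
rewrite (reindex (fun p : bool * m.-tuple bool => [tuple of p.1 :: p.2])) /=.
  rewrite -(pair_bigA _ (fun b (t : m.-tuple bool) =>
    (if b then accept_prob s u else 1 - accept_prob s u) *
      run_prob k n (step k n s u b) vs t *
        #|` centers (run k n (step k n s u b) vs t)|%:R)) /=.
  under eq_bigr do under eq_bigr do rewrite -mulrA.
  under eq_bigr do rewrite -big_distrr /= IH.
  by rewrite big_bool.
exists (fun t => (thead t, [tuple of behead t])) => [[b t] _|t _] /=.
  by congr (_, _); apply: val_inj.
by rewrite -tuple_eta.
Qed.

Lemma centers_step s u b :
  centers (step k n s u b) = if b then (u |` centers s)%fset else centers s.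
Proof. by rewrite /step; case: ifP. Qed.

Lemma card_centers_step s u b :
  #|` centers (step k n s u b)|%:R <= #|` centers s|%:R + b%:R :> R.
Proof.
rewrite centers_step -natrD ler_nat; case: b; last by rewrite addn0.
by rewrite cardfsU1 addnC leq_add2l leq_b1.
Qed.

Lemma fcost_step s u b : 0 <= fcost s -> fcost s <= fcost (step k n s u b).
Proof. by rewrite /step; case: ifP => _ /=; lra. Qed.

Lemma mean_centers_cons_le s u vs x : 0 < fcost s ->
  mean_centers (step k n s u true) vs <= x ->
  mean_centers (step k n s u false) vs <= x ->
  mean_centers s (u :: vs) <= x.
Proof.
move=> /(accept_prob_itv u) /andP[p0 p1] h1 h0 /=; nra.
Qed.

End Expectation.

(** * Potential bounds for late and early states *)

Section Potential.
Context {R : realType} {d n : nat} (k : nat) (v : n.-tuple 'rV[R]_d).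
Context {I : finType} (ring_of : 'I_n -> I) (B : 'I_n -> R) (theta : R).
Hypothesis theta_gt0 : 0 < theta.
Hypothesis ring_ofP : forall i j, ring_of i = ring_of j ->
  enorm (tnth v j - tnth v i) ^+ 2 <= B j.

Implicit Types (s : state R d) (C : {fset 'rV[R]_d}) (js : seq 'I_n).

Definition uncovered C : {set I} :=
  [set r | [forall i, (ring_of i == r) ==> (tnth v i \notin C)]].

(** Centers already selected, plus one first selection for each ring still without a center, plus a
    bound on the acceptance probability of each remaining point once its ring has one. *)
Definition late_potential s js : R :=
  #|` centers s|%:R + #|uncovered (centers s)|%:R + \sum_(j <- js) B j / theta.

Lemma uncoveredS C C' : (C `<=` C')%fset -> uncovered C' \subset uncovered C.
Proof.
move=> /fsubsetP CC'; apply/subsetP => r; rewrite !inE => /forallP h.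
apply/forallP => i; apply/implyP => ir.
by apply: contra (implyP (h i) ir); exact: CC'.
Qed.

Lemma uncovered_step s u b :
  #|uncovered (centers (step k n s u b))|%:R <= #|uncovered (centers s)|%:R :> R.
Proof.
rewrite ler_nat subset_leq_card // uncoveredS // centers_step.
by case: b; [exact: fsubsetU1 | exact: fsubset_refl].
Qed.

Lemma uncovered_fsetU1 C j : ring_of j \in uncovered C ->
  (#|uncovered (tnth v j |` C)%fset| < #|uncovered C|)%N.
Proof.
move=> jC; apply: proper_card; apply/properP; split.
  by apply: uncoveredS; exact: fsubsetU1.
exists (ring_of j) => //; rewrite inE; apply/negP => /forallP /(_ j).
by rewrite eqxx fset1U1.
Qed.

Lemma ring_diameter_ge0 j : 0 <= B j.
Proof. by apply: le_trans (ring_ofP (erefl (ring_of j))); exact: sqr_ge0. Qed.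

(** The potential does not grow on average. In an uncovered ring, a new center is paid for by the
    ring it covers; in a covered one, acceptance has probability at most [B j / theta], the term
    released by reading [j]. *)
Lemma mean_centers_late s js : theta <= fcost s ->
  mean_centers k n s (map (tnth v) js) <= late_potential s js.
Proof.
elim: js s => [|j js IH] s sf; rewrite /late_potential.
  by rewrite big_nil addr0 /= lerDl.
have f0 : 0 < fcost s by exact: lt_le_trans sf.
have h b : mean_centers k n (step k n s (tnth v j) b) (map (tnth v) js) <=
    late_potential (step k n s (tnth v j) b) js.
  by apply: IH; apply: le_trans sf _; apply: fcost_step; exact: ltW.
have := h true; have := h false; rewrite /late_potential {h} => h0 h1.
rewrite big_cons map_cons; set S := \sum_(_ <- _) _ in h0 h1 *.
have Bj : 0 <= B j / theta by rewrite divr_ge0 ?ring_diameter_ge0 ?ltW.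
have := card_centers_step k n s (tnth v j) false; rewrite addr0.
have := uncovered_step s (tnth v j) false.
have [jC|jC] := boolP (ring_of j \in uncovered (centers s)).
  move=> u0 c0; apply: mean_centers_cons_le => //; last by lra.
  have c1 := card_centers_step k n s (tnth v j) true.
  have := uncovered_fsetU1 jC; rewrite -(ler_nat R) -natr1 => u1.
  by move: h1 c1; rewrite centers_step mulr1n; lra.
move=> u0 c0.
have u1 := uncovered_step s (tnth v j) true.
have c1 := card_centers_step k n s (tnth v j) true.
have pB : accept_prob s (tnth v j) <= B j / theta.
  move: jC; rewrite inE negb_forall => /existsP[i].
  rewrite negb_imply negbK => /andP[/eqP ij iC].
  apply: le_trans (accept_prob_le _ f0 iC) _.
  apply: (@le_trans _ _ (B j / fcost s)).
    by rewrite ler_pM2r ?invr_gt0 // ring_ofP.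
  by rewrite ler_wpM2l ?ring_diameter_ge0 // lef_pV2.
have /andP[p0 p1] := accept_prob_itv (tnth v j) f0.
rewrite /=; move: h0 h1 u0 c0 u1 c1 pB p0 p1 => /=.
set p := accept_prob _ _.
nra.
Qed.

Let T : R := 3 * k%:R * (1 + log2 n%:R).

(** At most [m.+1] doublings separate [fcost s] from [theta]. A phase adds at most [T + 1] centers,
    the extra 1 being the selection that closes it; [quota s] is subtracted because those centers
    are already counted in the potential. *)
Lemma mean_centers_early m s js :
  0 < fcost s -> theta <= 2 ^+ m.+1 * fcost s -> (quota s)%:R <= T ->
  mean_centers k n s (map (tnth v) js) <=
    late_potential s js + m.+1%:R * (T + 1) - (quota s)%:R.
Proof.
elim: js m s => [|j js IH] m s f0 sf sq.
  rewrite /late_potential big_nil /=.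
  have : (0 : R) <= m%:R * (T + 1).
    by rewrite mulr_ge0 // addr_ge0 // (le_trans _ sq).
  have : (0 : R) <= #|uncovered (centers s)|%:R by [].
  by rewrite -natr1; lra.
suff h b : mean_centers k n (step k n s (tnth v j) b) (map (tnth v) js) <=
    late_potential s (j :: js) + m.+1%:R * (T + 1) - (quota s)%:R.
  by rewrite map_cons; apply: mean_centers_cons_le.
have u1 := uncovered_step s (tnth v j) b.
have c1 := card_centers_step k n s (tnth v j) b.
have b1 : b%:R <= 1 :> R by case: b {u1 c1}.
have Bj : 0 <= B j / theta by rewrite divr_ge0 ?ring_diameter_ge0 ?ltW.
have lateS : late_potential (step k n s (tnth v j) b) js <=
    late_potential s (j :: js) + b%:R.
  by rewrite /late_potential big_cons; lra.
have T0 : 0 <= T by exact: le_trans sq.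
have f0' := lt_le_trans f0 (fcost_step k n (tnth v j) b (ltW f0)).
set q : nat := if b then (quota s).+1 else quota s.
have qE : q%:R = (quota s)%:R + b%:R :> R.
  by rewrite /q; case: (b); rewrite ?addr0 // -natr1.
(* At a phase change the allowance [T + 1] of the finished phase covers [quota s] and the new
   center; otherwise the growth of the quota pays for that center. *)
have [Tq|Tq] := leP T q%:R.
  have fS : fcost (step k n s (tnth v j) b) = 2 * fcost s.
    by rewrite /step -/q -/T Tq.
  have qS : quota (step k n s (tnth v j) b) = 0%N.
    by rewrite /step -/q -/T Tq.
  case: m sf => [|m] sf.
    have sf' : theta <= fcost (step k n s (tnth v j) b) by rewrite fS -[2]expr1.
    have := mean_centers_late js sf'; lra.
  have sf' : theta <= 2 ^+ m.+1 * fcost (step k n s (tnth v j) b).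
    by rewrite fS mulrA -exprSr.
  have := IH m _ f0' sf'; rewrite qS => /(_ T0).
  rewrite -[m.+2%:R]natr1; lra.
have fS : fcost (step k n s (tnth v j) b) = fcost s.
  by rewrite /step -/q -/T leNgt Tq.
have qS : quota (step k n s (tnth v j) b) = q.
  by rewrite /step -/q -/T leNgt Tq.
have sf' : theta <= 2 ^+ m.+1 * fcost (step k n s (tnth v j) b) by rewrite fS.
have := IH m _ f0' sf'; rewrite qS => /(_ (ltW Tq)); lra.
Qed.

End Potential.

(** * Choice of the rings and of the constant *)

Theorem theorem1 (R : realType) :
  exists A : R, 0 < A /\
    forall (d n k : nat) (v : n.-tuple 'rV[R]_d) (w : R),
      (1 <= k)%N -> 0 < w -> w <= kmeans_opt k v ->
      expected_centers k w v <=
        A * (k%:R * log2 n%:R * Num.max 1 (log2 (kmeans_opt k v / w))).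
Proof.
(* 25 = 8 + 3 + 14: later selections in covered rings ([sumB]), number of rings ([card], with
   [l + 2 <= 3 * l]), and early phases ([mT]). *)
exists 25; split=> [//|d n k v w k0 w0].
have [[a [c WE]] _] := kmeans_opt_min v k0.
move: (@kmeans_opt_gt0_size R d n k v k0) WE.
set W := kmeans_opt k v => n2 WE wW.
have W0 : 0 < W by exact: lt_le_trans wW.
move: WE; rewrite kmeans_costE => WE.
have {}n2 := n2 W0.
have ln1 := log2_nat_ge1 (R := R) n2.
have n0 : (0 : R) < n%:R by rewrite ltr0n (leq_trans _ n2).
have k1 : (1 : R) <= k%:R by rewrite ler1n.
set l := log2 n%:R in ln1 *.
pose x j := enorm (tnth v j - c (a j)) ^+ 2.
have x0 j : 0 <= x j by exact: sqr_ge0.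
have [|L nL Ll] := @floor_log2 R n%:R; first by rewrite ler1n -(ltr0n R).
(* Each [x j] is at most the whole cost [W], and [n <= 2 ^ (L + 1)]; so scales 0 to [L.+1], that is
   [L.+2] rings per cluster, suffice. *)
have xW j : x j <= 2 ^+ L.+1 * (W / n%:R).
  apply: (@le_trans _ _ W).
    by rewrite WE (bigD1 j) //= lerDl sumr_ge0 // => i _; exact: x0.
  rewrite mulrCA ler_peMr //; first exact: ltW.
  by rewrite ler_pdivlMr // mul1r.
have /choice [t tP] j : exists t : 'I_L.+2,
    (x j <= 2 ^+ t * (W / n%:R)) && (2 ^+ t * (W / n%:R) <= 2 * x j + W / n%:R).
  have [t tL tP] := dyadic_scale (x0 j) (xW j).
  by exists (Ordinal (tL : (t < L.+2)%N)).
pose rho j := (a j, t j).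
(* For [i] and [j] in the same ring, [x i <= 2 * x j + W / n], hence [2 * (x i + x j) <= B j]. *)
pose B j := 6 * x j + 2 * (W / n%:R).
have rhoP i j : rho i = rho j -> enorm (tnth v j - tnth v i) ^+ 2 <= B j.
  move=> [aij tij]; apply: le_trans (enorm_sqr_triangle _ _ (c (a j))) _.
  have /andP[xi _] := tP i; have /andP[_ xj] := tP j.
  move: xi; rewrite tij {1}/x aij /B => xi.
  by rewrite -/(x j); lra.
have kl0 : 0 < k%:R * l by apply: mulr_gt0; lra.
pose theta := W / (k%:R * l).
have th0 : 0 < theta by rewrite divr_gt0.
have sumB : \sum_(j <- enum 'I_n) B j / theta = 8 * (k%:R * l).
  rewrite -big_distrl /= big_enum /= big_split /= -big_distrr /= -WE.
  rewrite sumr_const card_ord -mulr_natl /theta.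
  by field; rewrite !gt_eqF //; lra.
have [|m Wm mW] := @floor_log2 R (W / w); first by rewrite ler_pdivlMr // mul1r.
have f0 : 0 < fcost (init_state d k n w) by rewrite divr_gt0.
have fm : theta <= 2 ^+ m.+1 * fcost (init_state d k n w).
  rewrite /theta /= mulrA ler_pM2r ?invr_gt0 //.
  by rewrite -ler_pdivrMr.
have q0 : (quota (init_state d k n w))%:R <= 3 * k%:R * (1 + l).
  by rewrite /= mulr0n mulr_ge0 //; lra.
have := mean_centers_early th0 rhoP (enum 'I_n) f0 fm q0.
rewrite /expected_centers mean_centersE map_tnth_enum /late_potential sumB /=.
move=> /le_trans; apply.
rewrite -/l add0r subr0.
have card : #|uncovered v rho fset0|%:R <= k%:R * (l + 2) :> R.
  apply: (@le_trans _ _ (k * L.+2)%:R).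
    rewrite ler_nat; apply: leq_trans (max_card _) _.
    by rewrite card_prod !card_ord.
  rewrite natrM ler_pM2l; last by lra.
  by rewrite -2!natr1 -addrA lerD.
have mM : m.+1%:R <= 2 * Num.max 1 (log2 (W / w)).
  have : 1 <= Num.max 1 (log2 (W / w)) by rewrite le_max lexx.
  have : log2 (W / w) <= Num.max 1 (log2 (W / w)) by rewrite le_max lexx orbT.
  by rewrite -natr1; lra.
have M1 : 1 <= Num.max 1 (log2 (W / w)) by rewrite le_max lexx.
set M := Num.max _ _ in mM M1 *.
have kkl : k%:R <= k%:R * l by rewrite ler_peMr.
have T7 : 3 * k%:R * (1 + l) + 1 <= 7 * (k%:R * l) by lra.
have mT : m.+1%:R * (3 * k%:R * (1 + l) + 1) <= 2 * M * (7 * (k%:R * l)).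
  by apply: ler_pM => //; apply: addr_ge0 => //; apply: mulr_ge0; lra.
have klM : k%:R * l <= k%:R * l * M by rewrite ler_peMr // ltW.
lra.
Qed.
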